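(* Let $\tau$ and $\rho$ be patterns, regarded as subword (consecutive) patterns, each having largest letter $s$, and suppose $\tau\sim\rho$ as subword patterns. Let $\sigma$ be a non-empty monotonic pattern (its letters are weakly increasing or weakly decreasing), regarded as a subword pattern, with largest letter $t$. Then $$\tau\text{-}(\sigma+s)\sim \rho\text{-}(\sigma+s)\qquad\text{and}\qquad \sigma\text{-}(\tau+t)\sim \sigma\text{-}(\rho+t).$$
   Context: For $k\ge1$ let $[k]=\{1,\dots,k\}$; a $k$-ary word of length $n$ is an element of $[k]^n$. A pattern is a word $\sigma=\sigma_1\cdots\sigma_m\in[\ell]^m$ in which every letter of $[\ell]$ occurs. Two words are order-isomorphic if replacing the $i$-th smallest distinct letter by $i$ yields the same word. A vincular pattern is a pair $(\sigma,X)$ with $\sigma$ a pattern of length $m$ and $X\subseteq[m-1]$; it is written as $\sigma$ with a dash ''-'' inserted between $\sigma_j$ and $\sigma_{j+1}$ exactly when $j\notin X$. A word $w=w_1\cdots w_n$ contains $(\sigma,X)$ if there are indices $i_1<\dots<i_m$ with $w_{i_1}\cdots w_{i_m}$ order-isomorphic to $\sigma$ and $i_{j+1}=i_j+1$ for all $j\in X$; otherwise $w$ avoids it. A subword (consecutive) pattern is one with $X=[m-1]$ (no dashes). Let $a_\sigma(n,k)$ be the number of words in $[k]^n$ avoiding $\sigma$; patterns $\sigma,\tau$ are Wilf-equivalent, $\sigma\sim\tau$, if $a_\sigma(n,k)=a_\tau(n,k)$ for all $n\ge0$, $k\ge1$. For a pattern $\sigma$ and integer $s$, $\sigma+s$ denotes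 the word obtained by adding $s$ to every letter. For subword patterns $\alpha,\beta$, $\alpha\text{-}\beta$ denotes the vincular pattern whose underlying word is the concatenation $\alpha\beta$, with adjacency required between consecutive letters inside $\alpha$ and inside $\beta$, and a single dash between the last letter of $\alpha$ and the first of $\beta$. *)

(* Defs.v *)
From mathcomp Require Import all_boot zify.
Set Implicit Arguments.
Unset Strict Implicit.
Unset Printing Implicit Defensive.

(* Words are sequences of natural numbers; the letters of [k] are 1, ..., k. *)
Definition is_pattern (u : seq nat) : Prop :=
  exists l : nat, u =i iota 1 l.

Definition largest_letter (u : seq nat) (s : nat) : bool :=
  (s \in u) && all (fun x => x <= s) u.

Definition monotonic (u : seq nat) : bool := sorted leq u || sorted geq u.

(* Replaces the i-th smallest distinct letter of u by i (i = 1, 2, ...). *)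
Definition reduction (u : seq nat) : seq nat :=
  [seq (index x (sort leq (undup u))).+1 | x <- u].

Definition order_iso (u v : seq nat) : bool := reduction u == reduction v.

(* A pair (sigma, X), where X lists 1-based positions j such that the letters
   sigma_j and sigma_(j+1) must be matched by adjacent letters. *)
Record vincular := Vincular { vword : seq nat; vadj : seq nat }.

Definition is_vincular (p : vincular) : Prop :=
  is_pattern (vword p) /\ all (fun j => 0 < j < size (vword p)) (vadj p).

(* The positions i_1 < ... < i_m in w are 0-based, and i_j is the entry of
   index j.-1 of the tuple i. *)
Definition contains (p : vincular) (w : seq nat) : bool :=
  [exists i : (size (vword p)).-tuple 'I_(size w),
    let pos := map val i in
    [&& sorted ltn pos,
        order_iso [seq nth 0 w a | a <- pos] (vword p)
      & all (fun j => nth 0 pos j == (nth 0 pos j.-1).+1) (vadj p)]].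

Definition avoids (p : vincular) (w : seq nat) : bool := ~~ contains p w.

(* An element of [k]^n is a tuple over 'I_k = {0, ..., k-1}, whose letters are
   shifted by one. *)
Definition avoid_count (p : vincular) (n k : nat) : nat :=
  #|[set w : n.-tuple 'I_k | avoids p [seq (val x).+1 | x <- w]]|.

Definition wilf_equiv (p q : vincular) : Prop :=
  forall n k : nat, 1 <= k -> avoid_count p n k = avoid_count q n k.

Definition subword (u : seq nat) : vincular :=
  Vincular u (iota 1 (size u).-1).

Definition dash (u v : seq nat) : vincular :=
  Vincular (u ++ v) (iota 1 (size u).-1 ++ iota (size u).+1 (size v).-1).

Definition shift (u : seq nat) (s : nat) : seq nat := [seq x + s | x <- u].

Lemma is_vincular_subword (u : seq nat) :
  is_pattern u -> is_vincular (subword u).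
Proof.
by move=> pu; split=> //=; apply/allP=> j; rewrite mem_iota; lia.
Qed.

Lemma is_vincular_dash (u v : seq nat) (s : nat) :
  is_pattern u -> largest_letter u s -> is_pattern v -> 0 < size v ->
  is_vincular (dash u (shift v s)).
Proof.
move=> [l ul] /andP[su /allP us] [l' vl] v0; split; last first.
  have u0 : 0 < size u by case: (u) su.
  by apply/allP=> j /=; rewrite mem_cat !mem_iota size_cat size_map; lia.
have els : l = s.
  have : s \in iota 1 l by rewrite -ul.
  rewrite mem_iota => sl.
  have : l <= s by apply: us; rewrite ul mem_iota; lia.
  lia.
exists (s + l') => x; rewrite /= mem_cat ul els iotaD mem_cat; congr (_ || _).
apply/mapP/idP=> [[y]|]; first by rewrite vl !mem_iota => hy ->; lia.
rewrite mem_iota => hx.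
by exists (x - s); [rewrite vl mem_iota; lia | lia].
Qed.

(* Main.v *)
Require Import Defs.
From mathcomp Require Import all_boot zify.

(** Read a word from right to left. Once a suffix [v] is known, let [a] be the
    largest bound such that [sigma] occurs in [v] in letters exceeding [a]; an
    occurrence of [tau] ending just before [v] is forbidden exactly when its
    letters are all [<= a]. Letters [<= a] neither change [a] nor take part in
    later occurrences of [sigma] that matter, so in a word [u c r v], with [r] a
    run of letters [<= a] and [c > a], the only constraint on [r] is to avoid
    [tau] over the alphabet [[a]], and the constraint on [u] depends on [r] only
    through its length. This gives a recursion for the number of avoiders in
    which [tau] enters only through its avoidance numbers as a subword pattern.
    Reversal and complement turn the second equivalence into the first. *)

Set Implicit Arguments.
Unset Strict Implicit.
Unset Printing Implicit Defensive.

(** * Order isomorphism *)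

Lemma leq_index_sort_undup (u : seq nat) :
  {in u &, forall x y, (index x (sort leq (undup u)) <=
                        index y (sort leq (undup u))) = (x <= y)}.
Proof.
set q := sort leq (undup u) => x y xu yu.
have index_leq a b : a \in u -> b \in u -> index a q <= index b q -> a <= b.
  move=> au bu; apply: (sorted_leq_index leq_trans leqnn);
    by rewrite ?mem_sort ?mem_undup ?sort_sorted //; apply: leq_total.
apply/idP/idP=> [|xy]; first exact: index_leq.
case: leqP => // lt_yx; have yx := index_leq _ _ yu xu (ltnW lt_yx).
have exy : x = y by apply/eqP; rewrite eqn_leq xy.
by rewrite exy ltnn in lt_yx.
Qed.

Lemma reduction_map (f : nat -> nat) (u : seq nat) :
  {in u &, {mono f : x y / x <= y}} -> reduction (map f u) = reduction u.
Proof.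
move=> f_mono; have f_inj : {in u &, injective f}.
  move=> x y xu yu fxy; apply/eqP.
  by rewrite eqn_leq -(f_mono x y) // -(f_mono y x) // fxy leqnn.
have mem_letters z : (z \in sort leq (undup u)) = (z \in u).
  by rewrite mem_sort mem_undup.
have uniq_map_letters : uniq (map f (sort leq (undup u))).
  rewrite map_inj_in_uniq ?sort_uniq ?undup_uniq // => x y.
  by rewrite !mem_letters; apply: f_inj.
have sort_undup_map :
    sort leq (undup (map f u)) = map f (sort leq (undup u)).
  apply: (sorted_eq leq_trans anti_leq); first exact/sort_sorted/leq_total.
  - rewrite (@mono_sorted_in _ _ (mem u) f leq leq) //.
      exact/sort_sorted/leq_total.
    by apply/allP=> z; rewrite mem_letters.
  - apply: uniq_perm => //; first by rewrite sort_uniq undup_uniq.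
    by move=> z; rewrite mem_sort mem_undup (eq_mem_map _ mem_letters).
rewrite /reduction -map_comp sort_undup_map.
apply/eq_in_map=> x xu /=; congr _.+1.
have xq : x \in sort leq (undup u) by rewrite mem_letters.
rewrite -{1}(nth_index 0 xq) -(nth_map 0 0) ?index_mem //.
by rewrite index_uniq ?size_map ?index_mem.
Qed.

Lemma order_isoP (u v : seq nat) :
  reflect (size u = size v /\
           forall i j, i < size u -> j < size u ->
             (nth 0 u i <= nth 0 u j) = (nth 0 v i <= nth 0 v j))
          (order_iso u v).
Proof.
apply: (iffP eqP) => [uv | [suv uv]].
  have suv : size u = size v by have := congr1 size uv; rewrite !size_map.
  split=> // i j iu ju.
  have rankE a : a < size u -> index (nth 0 u a) (sort leq (undup u)) =
                               index (nth 0 v a) (sort leq (undup v)).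
    move=> au; have := congr1 (nth 0 ^~ a) uv.
    by rewrite !(nth_map 0) -?suv // => -[].
  rewrite -(leq_index_sort_undup (u := u)) ?mem_nth // !rankE //.
  by rewrite leq_index_sort_undup // mem_nth // -suv.
pose f x := nth 0 v (index x u).
have f_nth i : i < size u -> f (nth 0 u i) = nth 0 v i.
  move=> iu; have ju : index (nth 0 u i) u < size u.
    by rewrite index_mem mem_nth.
  by apply/eqP; rewrite eqn_leq /f -!uv // nth_index ?mem_nth ?leqnn.
have -> : v = map f u.
  apply: (@eq_from_nth _ 0) => [|i]; first by rewrite size_map.
  by rewrite -suv => iu; rewrite (nth_map 0) // f_nth.
rewrite /order_iso reduction_map // => x y xu yu.
by rewrite /f -uv ?index_mem // !nth_index.
Qed.

Lemma order_iso_size (u v : seq nat) : order_iso u v -> size u = size v.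
Proof. by case/order_isoP. Qed.

Lemma allrel_nthP (T S : Type) (r : T -> S -> bool) (x0 : T) (y0 : S)
    (u : seq T) (v : seq S) :
  reflect (forall i j, i < size u -> j < size v -> r (nth x0 u i) (nth y0 v j))
          (allrel r u v).
Proof.
apply: (iffP (all_nthP x0)) => [uv i j iu | uv i iu].
  exact/(all_nthP y0)/uv.
by apply/(all_nthP y0)=> j; apply: uv.
Qed.

Lemma order_iso_cat (x y u v : seq nat) :
  allrel ltn u v -> size x = size u ->
  order_iso (x ++ y) (u ++ v) =
  [&& order_iso x u, order_iso y v & allrel ltn x y].
Proof.
move=> /(allrel_nthP _ 0 0) uv sx.
apply/order_isoP/and3P=> [[] | []].
  rewrite !size_cat => sz iso; have {sz} sy : size y = size v by lia.
  split.
  - apply/order_isoP; split=> // i j ix jx.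
    by have := iso i j; rewrite !nth_cat -sx ix jx; apply; lia.
  - apply/order_isoP; split=> // i j iy jy.
    have := iso (size x + i) (size x + j).
    by rewrite !nth_cat -sx !ltnNge !leq_addr /= !addKn; apply; lia.
  - apply/(allrel_nthP _ 0 0)=> i j ix jy; rewrite /= ltnNge.
    have jF : (size x + j < size x) = false by lia.
    have := iso (size x + j) i; rewrite !nth_cat -sx ix jF !addKn.
    by move=> ->; [rewrite -ltnNge; apply: uv; lia | lia | lia].
move=> /order_isoP[_ xu] /order_isoP[sy yv] /(allrel_nthP _ 0 0) xy.
rewrite !size_cat sx sy; split=> // i j iuv juv; rewrite !nth_cat sx.
case: (ltnP i) => iu; case: (ltnP j) => ju.
- by apply: xu; rewrite sx.
- have /= := uv i (j - size u); have /= := xy i (j - size u); lia.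
- have /= := uv j (i - size u); have /= := xy j (i - size u); lia.
- by apply: yv; lia.
Qed.

Lemma order_iso_shift (u : seq nat) (s : nat) : order_iso (shift u s) u.
Proof. by apply/eqP/reduction_map=> x y _ _; rewrite leq_add2r. Qed.

Lemma order_iso_rev (u v : seq nat) :
  order_iso u v -> order_iso (rev u) (rev v).
Proof.
move=> /order_isoP[suv uv]; apply/order_isoP; rewrite !size_rev.
by split=> // i j iu ju; rewrite !nth_rev -?suv // uv; lia.
Qed.

Definition complement (k : nat) (u : seq nat) : seq nat :=
  [seq k.+1 - x | x <- u].

Lemma order_iso_complement (k l : nat) (u v : seq nat) :
  all (leq^~ k) u -> all (leq^~ l) v ->
  order_iso (complement k u) (complement l v) = order_iso u v.
Proof.
move=> /(all_nthP 0) uk /(all_nthP 0) vl.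
have [suv | nsuv] := eqVneq (size u) (size v); last first.
  by apply/idP/idP=> /order_iso_size; rewrite ?size_map => /eqP;
    rewrite (negbTE nsuv).
have complement_leq i j : i < size u -> j < size u ->
    (nth 0 (complement k u) i <= nth 0 (complement k u) j) =
    (nth 0 u j <= nth 0 u i) /\
    (nth 0 (complement l v) i <= nth 0 (complement l v) j) =
    (nth 0 v j <= nth 0 v i).
  move=> iu ju; rewrite !(nth_map 0) -?suv //.
  have /= := uk i iu; have /= := uk j ju; have /= := vl i; have /= := vl j.
  by rewrite -suv => /(_ ju) + /(_ iu); lia.
apply/order_isoP/order_isoP; rewrite !size_map => -[_ uv]; split=> // i j iu ju.
  by have [eu ev] := complement_leq j i ju iu; rewrite -eu -ev uv.
by have [-> ->] := complement_leq i j iu ju; apply: uv.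
Qed.

(** * Containment *)

Definition adjacent_at (pos X : seq nat) : bool :=
  all (fun j => nth 0 pos j == (nth 0 pos j.-1).+1) X.

Lemma containsP (p : vincular) (w : seq nat) :
  reflect (exists pos : seq nat,
             [/\ size pos = size (vword p), all (ltn^~ (size w)) pos,
                 sorted ltn pos,
                 order_iso [seq nth 0 w a | a <- pos] (vword p)
               & adjacent_at pos (vadj p)])
          (contains p w).
Proof.
apply: (iffP existsP) => [[i /and3P[ltni iso adj]] | [pos [sp pw lp iso adj]]].
  exists (map val i); split; rewrite ?size_map ?size_tuple //.
  by apply/allP=> _ /mapP[a _ ->]; apply: (ltn_ord a).
have [i ei] : exists i : (size (vword p)).-tuple 'I_(size w), map val i = pos.
  have [w0 | w0] := posnP (size w).
    have p0 : pos = [::] by case: (pos) pw => //= a l; rewrite w0.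
    by rewrite p0 in sp; rewrite -sp p0; exists [tuple].
  have st : size [seq insubd (Ordinal w0) a | a <- pos] == size (vword p).
    by rewrite size_map sp.
  exists (Tuple st); rewrite -map_comp map_id_in // => a /(allP pw) /= aw.
  by rewrite val_insubd aw.
by exists i; rewrite ei; apply/and3P.
Qed.

Lemma eq_contains (p q : vincular) (w : seq nat) :
  order_iso (vword p) (vword q) -> vadj p =i vadj q ->
  contains p w = contains q w.
Proof.
move=> pq adj; have spq := order_iso_size pq.
have iso_pq x : order_iso x (vword p) = order_iso x (vword q).
  by rewrite /order_iso (eqP pq).
apply/containsP/containsP=> -[pos [sp pw lp iso adjp]]; exists pos.
  by split; rewrite -?spq /adjacent_at -?(eq_all_r adj) -?iso_pq.
by split; rewrite ?spq /adjacent_at ?(eq_all_r adj) ?iso_pq.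
Qed.

Definition consecutive (pos : seq nat) : bool :=
  adjacent_at pos (iota 1 (size pos).-1).

Lemma consecutiveP (pos : seq nat) :
  reflect (exists a, pos = iota a (size pos)) (consecutive pos).
Proof.
apply: (iffP allP) => [adj | [a ->] j]; last first.
  by rewrite mem_iota size_iota => jn; rewrite !nth_iota; lia.
exists (nth 0 pos 0); apply: (@eq_from_nth _ 0) => [|i ilt].
  by rewrite size_iota.
rewrite nth_iota //; elim: i ilt => [|i IHi] ilt; first by rewrite addn0.
rewrite addnS -IHi; last lia.
by apply/eqP/adj; rewrite mem_iota; lia.
Qed.

Lemma consecutive_catP (m n : nat) (pos : seq nat) : size pos = m + n ->
  reflect (exists a b, pos = iota a m ++ iota b n)
          (adjacent_at pos (iota 1 m.-1 ++ iota m.+1 n.-1)).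
Proof.
move=> smn; rewrite -(cat_take_drop m pos).
have : size (take m pos) = m by rewrite size_takel ?smn ?leq_addr.
have : size (drop m pos) = n by rewrite size_drop smn addKn.
move: (take m pos) (drop m pos) => l r <- <-.
suff -> : adjacent_at (l ++ r)
              (iota 1 (size l).-1 ++ iota (size l).+1 (size r).-1) =
          consecutive l && consecutive r.
  apply: (iffP andP) => [[/consecutiveP[a lE] /consecutiveP[b rE]] | [a [b]]].
    by exists a, b; rewrite -lE -rE.
  move/eqP; rewrite eqseq_cat ?size_iota // => /andP[/eqP lE /eqP rE].
  by split; apply/consecutiveP; [exists a | exists b].
rewrite /adjacent_at all_cat; congr andb.
  apply: eq_in_all=> j; rewrite mem_iota => jl; rewrite !nth_cat.
  have -> : j < size l by lia.
  by have -> : j.-1 < size l by lia.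
rewrite -(addn1 (size l)) iotaDl all_map; apply: eq_in_all=> j.
rewrite mem_iota /= !nth_cat => jr.
have -> : (size l + j).-1 = size l + j.-1 by lia.
by rewrite !ltnNge !leq_addr /= !addKn.
Qed.

Lemma all_ltn_iota (a n N : nat) :
  all (ltn^~ N) (iota a n) = (n == 0) || (a + n <= N).
Proof.
case: n => //= n; apply/andP/idP=> [[aN /allP nN] | anN].
  case: n nN => [|n] nN; first lia.
  by have := nN (a + n.+1); rewrite mem_iota /=; lia.
by split; [|apply/allP=> j; rewrite mem_iota /=]; lia.
Qed.

Lemma sorted_iota_cat (a m b n : nat) : 0 < m -> 0 < n ->
  sorted ltn (iota a m ++ iota b n) = (a + m <= b).
Proof.
move=> m0 n0; rewrite (sorted_pairwise ltn_trans) pairwise_cat.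
rewrite -!(sorted_pairwise ltn_trans) !iota_ltn_sorted !andbT.
apply/allrelP/idP=> [ab | ab x y].
  by have /= := ab (a + m.-1) b; rewrite !mem_iota; lia.
by rewrite !mem_iota /=; lia.
Qed.

Lemma map_nth_iota_cat (T : Type) (x0 : T) (p x q : seq T) :
  [seq nth x0 (p ++ x ++ q) a | a <- iota (size p) (size x)] = x.
Proof.
rewrite map_nth_iota ?drop_size_cat ?take_size_cat //.
by rewrite !size_cat; lia.
Qed.

Lemma seq_split_at (T : Type) (a m : nat) (w : seq T) : a + m <= size w ->
  exists p x q, [/\ w = p ++ x ++ q, size p = a & size x = m].
Proof.
move=> amw; exists (take a w), (take m (drop a w)), (drop m (drop a w)).
by rewrite !cat_take_drop !size_takel ?size_drop //; lia.
Qed.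

Lemma seq_split2_at (T : Type) (a m b n : nat) (w : seq T) :
  a + m <= b -> b + n <= size w ->
  exists p x q y z, [/\ w = p ++ x ++ q ++ y ++ z, size p = a, size x = m,
                        size (p ++ x ++ q) = b & size y = n].
Proof.
move=> ab bw; have [|p [x [t [wE pE xE]]]] := @seq_split_at _ a m w; first lia.
have [|q [y [z [tE qE yE]]]] := @seq_split_at _ (b - (a + m)) n t.
  by move: bw; rewrite wE !size_cat; lia.
by exists p, x, q, y, z; rewrite wE tE !size_cat; split=> //; lia.
Qed.

Lemma map_nth_iota_cat2 (T : Type) (x0 : T) (p x q y z : seq T) :
  [seq nth x0 (p ++ x ++ q ++ y ++ z) a |
     a <- iota (size p) (size x) ++ iota (size (p ++ x ++ q)) (size y)] =
  x ++ y.
Proof.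
rewrite map_cat map_nth_iota_cat; congr (_ ++ _).
have -> : p ++ x ++ q ++ y ++ z = (p ++ x ++ q) ++ y ++ z by rewrite -!catA.
exact: map_nth_iota_cat.
Qed.

Lemma contains_subwordP (u w : seq nat) :
  reflect (exists p x q, w = p ++ x ++ q /\ order_iso x u)
          (contains (subword u) w).
Proof.
apply: (iffP (containsP _ _)) => /=.
  move=> [pos [<- + _ + /consecutiveP[a posE]]].
  rewrite posE all_ltn_iota; have [s0 _ | s0 /= aw] := eqVneq.
    by rewrite s0 => iso; exists [::], [::], w.
  have [p [x [q [-> <- <-]]]] := seq_split_at aw.
  by rewrite map_nth_iota_cat; exists p, x, q.
move=> [p [x [q [-> iso]]]]; exists (iota (size p) (size x)).
rewrite size_iota -(order_iso_size iso) map_nth_iota_cat iota_ltn_sorted.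
split=> //; first by rewrite all_ltn_iota !size_cat; lia.
suff : consecutive (iota (size p) (size x)) by rewrite /consecutive size_iota.
by apply/consecutiveP; exists (size p); rewrite size_iota.
Qed.

Lemma contains_dashP (u v w : seq nat) :
  0 < size u -> 0 < size v -> allrel ltn u v ->
  reflect (exists p x q y z, [/\ w = p ++ x ++ q ++ y ++ z,
                                 order_iso x u, order_iso y v & allrel ltn x y])
          (contains (dash u v) w).
Proof.
move=> u0 v0 uv; apply: (iffP (containsP _ _)) => /=.
  move=> [pos []]; rewrite size_cat => sp.
  move=> + + + /(consecutive_catP sp)[a [b posE]].
  rewrite posE all_cat !all_ltn_iota sorted_iota_cat // (gtn_eqF v0) /=.
  move=> /andP[_ bw] ab.
  have [p [x [q [y [z [-> <- sx <- sy]]]]]] := seq_split2_at ab bw.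
  rewrite -{1}sx -{1}sy map_nth_iota_cat2 order_iso_cat // => /and3P[xu yv xy].
  by exists p, x, q, y, z.
move=> [p [x [q [y [z [-> xu yv xy]]]]]].
have [sx sy] := (order_iso_size xu, order_iso_size yv).
exists (iota (size p) (size x) ++ iota (size (p ++ x ++ q)) (size y)).
have s_pos : size (iota (size p) (size x) ++ iota (size (p ++ x ++ q)) (size y))
             = size u + size v by rewrite size_cat !size_iota sx sy.
rewrite map_nth_iota_cat2 order_iso_cat // xu yv xy s_pos (size_cat u).
split=> //.
- by rewrite all_cat !all_ltn_iota !size_cat; lia.
- by rewrite sorted_iota_cat ?sx ?sy // !size_cat; lia.
- apply/(consecutive_catP s_pos); exists (size p), (size (p ++ x ++ q)).
  by rewrite sx sy.
Qed.

(** * Reversal and complement *)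

Definition vadj_bounded (p : vincular) : bool :=
  all (fun j => 0 < j < size (vword p)) (vadj p).

Definition vincular_rev (p : vincular) : vincular :=
  Vincular (rev (vword p)) [seq size (vword p) - j | j <- vadj p].

Definition vincular_complement (l : nat) (p : vincular) : vincular :=
  Vincular (complement l (vword p)) (vadj p).

Lemma vincular_revK (p : vincular) :
  vadj_bounded p -> vincular_rev (vincular_rev p) = p.
Proof.
case: p => u X /allP /= Xu; rewrite /vincular_rev /= revK size_rev -map_comp.
by congr Vincular; apply: map_id_in => j /Xu /=; lia.
Qed.

Lemma contains_rev (p : vincular) (w : seq nat) :
  vadj_bounded p -> contains p w -> contains (vincular_rev p) (rev w).
Proof.
move=> /allP adj_lt /containsP[pos [sp /allP pw lp iso /allP adj]].
apply/containsP; exists (rev [seq size w - a.+1 | a <- pos]).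
split; rewrite /= ?size_rev ?size_map //.
- by rewrite all_rev all_map; apply/allP=> a /pw /=; lia.
- rewrite rev_sorted; apply: (homo_sorted_in (P := mem pos)) lp => //.
  by move=> a b /pw /= aw /pw /= bw; lia.
- rewrite map_rev -map_comp (_ : map _ pos = [seq nth 0 w a | a <- pos]).
    exact: order_iso_rev.
  by apply/eq_in_map=> a /pw /= aw; rewrite nth_rev; [congr nth |]; lia.
- rewrite /adjacent_at all_map; apply/allP=> j jX /=.
  have := adj_lt j jX; rewrite -sp => jp.
  rewrite !nth_rev ?size_map; try lia.
  rewrite !(nth_map 0); try lia.
  have -> : size pos - (size pos - j).+1 = j.-1 by lia.
  have -> : size pos - (size pos - j).-1.+1 = j by lia.
  have /pw /= : nth 0 pos j \in pos by rewrite mem_nth //; case/andP: jp.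
  by rewrite (eqP (adj j jX)); lia.
Qed.

Lemma contains_revE (p : vincular) (w : seq nat) :
  vadj_bounded p -> contains (vincular_rev p) (rev w) = contains p w.
Proof.
move=> adj; apply/idP/idP; last exact: contains_rev.
rewrite -{2}(vincular_revK adj) -{2}(revK w); apply: contains_rev.
by rewrite /vadj_bounded /= size_rev all_map; apply: sub_all adj => j /=; lia.
Qed.

Lemma contains_complement (l k : nat) (p : vincular) (w : seq nat) :
  all (leq^~ l) (vword p) -> all (leq^~ k) w ->
  contains (vincular_complement l p) (complement k w) = contains p w.
Proof.
move=> pl wk.
have isoE pos : all (ltn^~ (size w)) pos ->
    order_iso [seq nth 0 (complement k w) a | a <- pos] (complement l (vword p))
    = order_iso [seq nth 0 w a | a <- pos] (vword p).
  move=> /allP pw; rewrite -(order_iso_complement (k := k) _ pl); last first.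
    by apply/allP=> _ /mapP[a /pw /= aw ->]; apply: (all_nthP 0 wk).
  congr order_iso; rewrite /complement -map_comp; apply/eq_in_map=> a /pw aw /=.
  by rewrite (nth_map 0).
apply/containsP/containsP=> -[pos [sp pw lp iso adj]]; exists pos; split=> //.
- by rewrite sp size_map.
- by move: pw; rewrite size_map.
- by rewrite -isoE //; move: pw; rewrite size_map.
- by rewrite sp /= size_map.
- by rewrite size_map.
- by rewrite /= isoE.
Qed.

Definition letters (k n : nat) (w : n.-tuple 'I_k) : seq nat :=
  [seq (val x).+1 | x <- w].

Lemma all_letters (k n : nat) (w : n.-tuple 'I_k) :
  all (fun x => 0 < x <= k) (letters w).
Proof. by apply/allP=> _ /mapP[x _ ->] /=; apply: ltn_ord. Qed.

Lemma avoid_count_bij (p q : vincular) (n k : nat)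
    (f : n.-tuple 'I_k -> n.-tuple 'I_k) :
  injective f ->
  (forall w, contains q (letters (f w)) = contains p (letters w)) ->
  avoid_count p n k = avoid_count q n k.
Proof.
move=> f_inj pq; rewrite -[RHS](card_preimset _ f_inj).
by apply: eq_card => w; rewrite !inE /avoids -pq.
Qed.

Lemma eq_avoid_count (p q : vincular) (n k : nat) :
  order_iso (vword p) (vword q) -> vadj p =i vadj q ->
  avoid_count p n k = avoid_count q n k.
Proof.
move=> pq adj; apply: (@avoid_count_bij _ _ _ _ id) => // w.
exact/esym/eq_contains.
Qed.

Lemma avoid_count_rev (p : vincular) (n k : nat) :
  vadj_bounded p -> avoid_count (vincular_rev p) n k = avoid_count p n k.
Proof.
move=> adj; apply/esym/(@avoid_count_bij _ _ _ _ (fun w => [tuple of rev w])).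
  by move=> u v /(congr1 val) /= /(can_inj revK) /val_inj.
by move=> w; rewrite /letters map_rev contains_revE.
Qed.

Lemma avoid_count_complement (l : nat) (p : vincular) (n k : nat) :
  all (leq^~ l) (vword p) ->
  avoid_count (vincular_complement l p) n k = avoid_count p n k.
Proof.
move=> pl; apply/esym.
apply: (@avoid_count_bij _ _ _ _ (fun w => [tuple of map (@rev_ord k) w])).
  by move=> u v /(congr1 val) /= /(inj_map rev_ord_inj) /val_inj.
move=> w; rewrite -[RHS](contains_complement (k := k) pl); last first.
  by apply: sub_all (all_letters w) => x /andP[].
congr contains; rewrite /complement /letters -!map_comp.
by apply: eq_map => x /=; have := ltn_ord x; lia.
Qed.

Definition revcomp (k : nat) (u : seq nat) : seq nat := rev (complement k u).

Lemma avoid_count_subword_revcomp (l : nat) (u : seq nat) (n k : nat) :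
  all (leq^~ l) u ->
  avoid_count (subword (revcomp l u)) n k = avoid_count (subword u) n k.
Proof.
move=> ul; rewrite -(avoid_count_complement n k (p := subword u) ul).
rewrite -[RHS]avoid_count_rev /vadj_bounded /=; last first.
  by rewrite size_map; apply/allP=> j; rewrite mem_iota; lia.
apply: eq_avoid_count; rewrite /order_iso //= => j.
rewrite size_rev !size_map mem_iota; apply/idP/mapP=> [jl | [i]].
  by exists (size u - j); rewrite ?mem_iota; lia.
by rewrite mem_iota; lia.
Qed.

Lemma avoid_count_dash_revcomp (l : nat) (u v : seq nat) (n k : nat) :
  0 < size u -> 0 < size v -> all (leq^~ l) u -> all (leq^~ l) v ->
  avoid_count (dash (revcomp l v) (revcomp l u)) n k =
  avoid_count (dash u v) n k.
Proof.
move=> u0 v0 ul vl; rewrite -(@avoid_count_complement l (dash u v)); last first.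
  by rewrite all_cat ul.
rewrite -[RHS]avoid_count_rev /vadj_bounded /=; last first.
  rewrite size_map size_cat; apply/allP=> j.
  by rewrite mem_cat !mem_iota; lia.
apply: eq_avoid_count => [|j].
  by rewrite /order_iso /= /complement map_cat rev_cat.
rewrite /= !size_rev !size_map size_cat mem_cat !mem_iota.
apply/idP/mapP=> [jl | [i]].
  by exists (size u + size v - j); rewrite ?mem_cat ?mem_iota; lia.
by rewrite mem_cat !mem_iota; lia.
Qed.

Lemma avoid_count_subword_shift (u : seq nat) (s n k : nat) :
  avoid_count (subword (shift u s)) n k = avoid_count (subword u) n k.
Proof.
apply: eq_avoid_count => [|j]; first exact: order_iso_shift.
by rewrite /= size_map.
Qed.

(** * Enumeration of words *)

Fixpoint words (k n : nat) : seq (seq nat) :=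
  if n is m.+1 then [seq rcons u x | x <- iota 1 k, u <- words k m]
  else [:: [::]].

Lemma mem_words (k n : nat) (w : seq nat) :
  (w \in words k n) = (size w == n) && all (fun x => 0 < x <= k) w.
Proof.
elim: n w => [|n IHn] w /=; first by rewrite inE size_eq0; case: w.
apply/allpairsP/idP=> [[[x u]] /= [] |].
  rewrite mem_iota IHn => xk /andP[/eqP su uk] ->.
  by rewrite size_rcons su eqxx all_rcons uk; lia.
case/lastP: w => [|u x] //; rewrite size_rcons eqSS all_rcons.
move=> /and3P[su xk uk]; exists (x, u); split=> //=.
  by rewrite mem_iota; lia.
by rewrite IHn su.
Qed.

Lemma size_words (k n : nat) : size (words k n) = k ^ n.
Proof. by elim: n => //= n IHn; rewrite size_allpairs size_iota IHn expnS. Qed.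

Lemma avoid_count_words (p : vincular) (n k : nat) :
  avoid_count p n k = \sum_(w <- words k n) avoids p w.
Proof.
have letters_inj : injective (@letters k n).
  by move=> u v /inj_map uv; apply/val_inj/uv=> i j [] /val_inj.
pose ws := [seq letters w | w <- enum {: n.-tuple 'I_k}].
have ws_uniq : uniq ws by rewrite map_inj_uniq // enum_uniq.
have ws_words : {subset ws <= words k n}.
  move=> _ /mapP[w _ ->].
  by rewrite mem_words size_map size_tuple eqxx all_letters.
have size_ws : size (words k n) <= size ws.
  by rewrite size_words size_map -cardE card_tuple card_ord.
have words_uniq := leq_size_uniq ws_uniq ws_words size_ws.
have [_ mem_ws] := uniq_min_size ws_uniq ws_words size_ws.
rewrite -(perm_big _ (uniq_perm ws_uniq words_uniq mem_ws)).
rewrite big_map big_enum /avoid_count -sum1_card big_mkcond.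
by apply: eq_bigr => w _; rewrite inE; case: (avoids _ _).
Qed.

Lemma sum_words_recr (k n : nat) (f : seq nat -> nat) :
  \sum_(w <- words k n.+1) f w =
  \sum_(x <- iota 1 k) \sum_(u <- words k n) f (rcons u x).
Proof. exact: big_allpairs_dep. Qed.

(* Splits a word at its last letter exceeding [a]. *)
Lemma sum_words_split (a k m : nat) (f : seq nat -> nat) : a <= k ->
  \sum_(w <- words k m) f w =
  \sum_(w <- words a m) f w +
  \sum_(j < m) \sum_(x <- iota a.+1 (k - a)) \sum_(r <- words a j)
    \sum_(u <- words k (m.-1 - j)) f (u ++ x :: r).
Proof.
move=> ak; elim: m f => [|m IHm] f; first by rewrite big_ord0 addn0.
rewrite !sum_words_recr -{1}(subnKC ak) iotaD big_cat /= add1n.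
under eq_bigr => y _ do rewrite IHm.
rewrite big_split /= -addnA; congr (_ + _).
rewrite big_ord_recl addnC /=; congr (_ + _).
  apply: eq_bigr => x _; rewrite big_seq1 subn0.
  by apply: eq_bigr => u _; rewrite cats1.
rewrite exchange_big; apply: eq_bigr => j _ /=.
rewrite exchange_big; apply: eq_bigr => x _ /=.
rewrite sum_words_recr; apply: eq_bigr => y _; apply: eq_bigr => r _.
have -> : m - bump 0 j = m.-1 - j by rewrite /bump; lia.
by apply: eq_bigr => u _; rewrite rcons_cat.
Qed.

(** * Largest letters and thresholds *)

Lemma largest_letter_exists (u : seq nat) :
  0 < size u -> exists m, largest_letter u m.
Proof.
move=> u0; have ex_letter : exists x, x \in u.
  by exists (nth 0 u 0); apply: mem_nth.
have [x xu|m mu um] := ex_maxnP ex_letter (m := \max_(x <- u) x).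
  exact: (leq_bigmax_seq x).
by exists m; rewrite /largest_letter mu; apply/allP.
Qed.

Lemma largest_letter_all_leq (u : seq nat) (m n : nat) :
  largest_letter u m -> all (leq^~ n) u = (m <= n).
Proof.
case/andP=> mu um; apply/allP/idP=> [|mn x xu]; first exact.
exact: leq_trans (allP um x xu) mn.
Qed.

Lemma largest_letter_allrel (u v : seq nat) (m : nat) :
  largest_letter u m -> allrel ltn u v = all (ltn m) v.
Proof.
case/andP=> mu /allP um; apply/allrelP/allP=> [uv y | mv x y xu yv].
  exact: uv.
exact: leq_ltn_trans (um x xu) (mv y yv).
Qed.

Definition occurs (T : Type) (P : seq T -> seq T -> bool) (w : seq T) : bool :=
  has (fun i => has (fun j => P (take j (drop i w)) (drop j (drop i w)))
    (iota 0 (size w).+1)) (iota 0 (size w).+1).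

Lemma occursP (T : Type) (P : seq T -> seq T -> bool) (w : seq T) :
  reflect (exists u x v, w = u ++ x ++ v /\ P x v) (occurs P w).
Proof.
apply: (iffP hasP) => [[i _ /hasP[j _ Pij]] | [u [x [v [-> Pxv]]]]].
  exists (take i w), (take j (drop i w)), (drop j (drop i w)).
  by rewrite !cat_take_drop.
exists (size u); first by rewrite mem_iota !size_cat; lia.
apply/hasP; exists (size x); first by rewrite mem_iota !size_cat; lia.
by rewrite drop_size_cat // take_size_cat // drop_size_cat.
Qed.

Lemma eq_occurs (T : Type) (P Q : seq T -> seq T -> bool) :
  P =2 Q -> occurs P =1 occurs Q.
Proof. by move=> PQ w; apply: eq_has => i; apply: eq_has => j; apply: PQ. Qed.

Lemma occurs_catr (T : Type) (P : seq T -> seq T -> bool) (u v : seq T) :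
  occurs P v -> occurs P (u ++ v).
Proof.
case/occursP=> p [x [z [-> Pxz]]]; apply/occursP; exists (u ++ p), x, z.
by rewrite -catA.
Qed.

Lemma eq_cat_split (T : Type) (u v x y : seq T) : u ++ v = x ++ y ->
  exists z, (u = x ++ z /\ y = z ++ v) \/ (x = u ++ z /\ v = z ++ y).
Proof.
elim: u x => [|a u IHu] [|b x] /=.
- by move=> ->; exists [::]; left.
- by move=> ->; exists (b :: x); right.
- by move=> <-; exists (a :: u); left.
- by case=> <- /IHu[z [[-> ->] | [-> ->]]]; exists z; [left | right].
Qed.

Lemma occurs_cat_cons (T : eqType) (P : seq T -> seq T -> bool) (u r : seq T)
    (c : T) :
  (forall x z, c \in x -> suffix z r -> ~~ P x z) ->
  occurs P (u ++ c :: r) =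
  occurs P r || occurs (fun x z => P x (z ++ c :: r)) u.
Proof.
move=> nP; apply/idP/orP=> [/occursP[p [x [z [+ Pxz]]]] | []]; last first.
- case/occursP=> p [x [z [-> Pxz]]]; apply/occursP.
  by exists p, x, (z ++ c :: r); rewrite -!catA.
- by rewrite -cat_rcons; apply: occurs_catr.
have c_notin t : r = t ++ z -> c \notin x.
  by move=> rE; apply: contraL Pxz => /nP; apply; apply/suffixP; exists t.
rewrite catA => /eq_cat_split[t [[-> zE] | [uE]]].
  by right; apply/occursP; exists p, x, t; rewrite -zE catA.
case: t uE => [|d t] /= uE.
  rewrite cats0 in uE => zE; right; apply/occursP.
  by exists p, x, [::]; rewrite cats0 uE zE.
case=> dE rE; rewrite -{}dE in uE; have cx := c_notin _ rE.
left; have [q [[pE] | [_ xE]]] := eq_cat_split uE; last first.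
  by rewrite xE mem_cat mem_head orbT in cx.
case: q pE => [|e q] _ /= [xE]; first by rewrite -xE mem_head in cx.
by move=> tE; apply/occursP; exists q, x, z; rewrite catA -tE.
Qed.

Section Threshold.

Variable sigma : seq nat.
Hypothesis sigma_gt0 : 0 < size sigma.

Definition occurs_above (b : nat) (w : seq nat) : bool :=
  occurs (fun x _ => order_iso x sigma && all (ltn b) x) w.

Lemma occurs_above_leq (v : seq nat) (b c : nat) :
  b <= c -> occurs_above c v -> occurs_above b v.
Proof.
move=> bc /occursP[p [x [q [-> /andP[xs xc]]]]].
apply/occursP; exists p, x, q; rewrite xs; split=> //.
by apply: sub_all xc => y; apply: leq_ltn_trans.
Qed.

Lemma occurs_above_cons (v : seq nat) (b y : nat) :
  y <= b -> occurs_above b (y :: v) -> occurs_above b v.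
Proof.
move=> yb /occursP[[|z p] [x [q [e /andP[xs xb]]]]].
  have sx := order_iso_size xs; case: x e sx {xs} xb => [|z x] /=; first lia.
  by move=> [<- _] _; lia.
by case: e => _ ->; apply/occursP; exists p, x, q; rewrite xs.
Qed.

Lemma occurs_above_mask (w : seq nat) (b : nat) :
  occurs_above b w = occurs_above b [seq if y <= b then 0 else y | y <- w].
Proof.
rewrite /occurs_above /occurs size_map.
apply: eq_has => i; apply: eq_has => j; rewrite -map_drop -map_take.
set x := take _ _.
have -> : all (ltn b) [seq if y <= b then 0 else y | y <- x] = all (ltn b) x.
  by rewrite all_map; apply: eq_all => y /=; case: (leqP y b).
case: (boolP (all (ltn b) x)) => [/allP xb | _]; rewrite ?andbF //.
by rewrite map_id_in // => y /xb /=; case: leqP.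
Qed.

(* The largest [b] such that [sigma] occurs in [v] in letters exceeding [b],
   with junk value [0] when [sigma] does not occur in [v]. *)
Definition threshold (v : seq nat) : nat :=
  \max_(b < \max_(y <- v) y | occurs_above b v) b.

Lemma occurs_aboveE (v : seq nat) (b : nat) :
  0 < b -> occurs_above b v = (b <= threshold v).
Proof.
move=> b0; apply/idP/idP=> [bv | ].
  have b_max : b < \max_(y <- v) y.
    case/occursP: (bv) => p [x [q [-> /andP[/order_iso_size xs xb]]]].
    case: x xs xb => [|y x] /= xs; first lia.
    case/andP=> yb _; apply: leq_trans yb _.
    by apply: (leq_bigmax_seq y) => //; rewrite !mem_cat mem_head orbT.
  exact: (leq_bigmax_cond (Ordinal b_max)).
apply: contraTT => nbv; rewrite -ltnNge -(prednK b0) ltnS.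
apply/bigmax_leqP=> c cv; rewrite -ltnS (prednK b0) ltnNge.
by apply: contra nbv => /occurs_above_leq; apply.
Qed.

Lemma threshold_leq (v w : seq nat) :
  (forall b, 0 < b -> occurs_above b v -> occurs_above b w) ->
  threshold v <= threshold w.
Proof.
move=> vw; have [-> // | t0] := posnP (threshold v).
by rewrite -occurs_aboveE //; apply: vw => //; rewrite occurs_aboveE.
Qed.

Lemma threshold_catr (u v : seq nat) : threshold v <= threshold (u ++ v).
Proof. by apply: threshold_leq => b _; apply: occurs_catr. Qed.

Lemma threshold_small_cat (r v : seq nat) :
  all (leq^~ (threshold v)) r -> threshold (r ++ v) = threshold v.
Proof.
elim: r => //= y r IHr /andP[yv /IHr <-]; apply/eqP.
rewrite eqn_leq (threshold_catr [:: y]) andbT; apply: threshold_leq => b b0.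
have [yb | /ltnW b_y _] := leqP y b; first exact: occurs_above_cons.
have bv : occurs_above b v by rewrite occurs_aboveE // (leq_trans b_y yv).
exact: occurs_catr bv.
Qed.

Lemma threshold_erase_small (u r v : seq nat) :
  all (leq^~ (threshold v)) r ->
  threshold (u ++ r ++ v) = threshold (u ++ nseq (size r) 0 ++ v).
Proof.
move=> /all_nthP rv.
have occursE b : 0 < b -> occurs_above b (u ++ r ++ v) =
    occurs_above b (u ++ nseq (size r) 0 ++ v).
  move=> b0; have [bv | tb] := leqP b (threshold v).
    have occ_v : occurs_above b v by rewrite occurs_aboveE.
    by rewrite /occurs_above !occurs_catr.
  rewrite occurs_above_mask [RHS]occurs_above_mask !map_cat.
  congr (occurs_above _ (_ ++ _ ++ _)).
  apply: (@eq_from_nth _ 0); rewrite !size_map ?size_nseq // => i ir.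
  rewrite !(nth_map 0) ?size_nseq // nth_nseq ir /= ifT //.
  exact: leq_trans (rv 0 i ir) (ltnW tb).
by apply/eqP; rewrite eqn_leq; apply/andP; split; apply: threshold_leq => b;
  move=> /occursE ->.
Qed.

Variable tau : seq nat.

(* When the letters of [w] are positive and those of [tau] lie below those of
   [sigma], this says that [dash tau sigma] has an occurrence in [w ++ v] whose
   first half lies in [w]. *)
Definition occurs_below (w v : seq nat) : bool :=
  occurs (fun x z => order_iso x tau && all (leq^~ (threshold (z ++ v))) x) w.

Lemma occurs_below_small (r v : seq nat) :
  all (leq^~ (threshold v)) r -> occurs_below r v = contains (subword tau) r.
Proof.
move=> rv; apply/occursP/contains_subwordP=> -[p [x [z [rE]]]].
  by case/andP=> xt _; exists p, x, z.
move=> xt; exists p, x, z; split=> //; rewrite xt.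
move: rv; rewrite rE !all_cat => /and3P[_ xv _].
by apply: sub_all xv => y yv; apply: leq_trans yv (threshold_catr _ _).
Qed.

(* A letter above the threshold cannot belong to the first half of an
   occurrence, so it separates the word into independent pieces. The letters of
   [r] are erased to [0] so that only their number is left. *)
Lemma occurs_below_cat (u r v : seq nat) (c : nat) :
  threshold v < c -> all (leq^~ (threshold v)) r ->
  occurs_below (u ++ c :: r) v =
  contains (subword tau) r || occurs_below u (c :: nseq (size r) 0 ++ v).
Proof.
move=> vc rv; rewrite /occurs_below occurs_cat_cons.
  rewrite -(occurs_below_small rv); congr orb; apply: eq_occurs => x z.
  by rewrite -!catA /= -!cat_rcons threshold_erase_small.
move=> x z cx /suffixP[q rE]; rewrite negb_and orbC.
suff -> : all (leq^~ (threshold (z ++ v))) x = false by [].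
rewrite threshold_small_cat; last by move: rv; rewrite rE all_cat => /andP[].
by apply/negbTE/allPn; exists c => //; rewrite /= -ltnNge.
Qed.

Lemma contains_dash_below (w : seq nat) :
  0 < size tau -> allrel ltn tau sigma -> all (leq 1) w ->
  contains (dash tau sigma) w = occurs_below w [::].
Proof.
move=> tau_gt0 tau_sigma w1.
have belowE x z : order_iso x tau -> all (leq 1) x ->
    all (leq^~ (threshold (z ++ [::]))) x =
    occurs (fun y _ => order_iso y sigma && allrel ltn x y) z.
  move=> /order_iso_size sx /allP x1; rewrite cats0.
  have [|m xm] := @largest_letter_exists x; first by rewrite sx.
  rewrite (largest_letter_all_leq _ xm) -occurs_aboveE; last first.
    by apply: x1; case/andP: xm.
  by apply: eq_occurs => y _; rewrite (largest_letter_allrel _ xm).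
apply/(contains_dashP _ tau_gt0 sigma_gt0 tau_sigma)/occursP.
  move=> [p [x [q [y [z [wE xt ys xy]]]]]]; exists p, x, (q ++ y ++ z).
  split=> //; move: w1; rewrite wE !all_cat => /and3P[_ x1 _].
  by rewrite xt belowE //; apply/occursP; exists q, y, z; rewrite ys.
move=> [p [x [t [wE /andP[xt]]]]].
move: w1; rewrite wE !all_cat => /and3P[_ x1 _]; rewrite belowE //.
by case/occursP=> q [y [z [-> /andP[ys xy]]]]; exists p, x, q, y, z.
Qed.

Definition avoid_below_count (k m : nat) (v : seq nat) : nat :=
  \sum_(w <- words k m) ~~ occurs_below w v.

Lemma avoid_count_dash (n k : nat) :
  0 < size tau -> allrel ltn tau sigma ->
  avoid_count (dash tau sigma) n k = avoid_below_count k n [::].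
Proof.
move=> tau_gt0 tau_sigma; rewrite avoid_count_words.
apply: eq_big_seq => w; rewrite mem_words => /andP[_ wk].
rewrite /avoids contains_dash_below //.
by apply: sub_all wk => x /andP[].
Qed.

Lemma avoid_below_count_recr (k m : nat) (v : seq nat) :
  let a := minn (threshold v) k in
  avoid_below_count k m v =
  avoid_count (subword tau) m a +
  \sum_(j < m) \sum_(c <- iota a.+1 (k - a))
    avoid_count (subword tau) j a *
    avoid_below_count k (m.-1 - j) (c :: nseq j 0 ++ v).
Proof.
move=> a.
have small j r : r \in words a j -> size r = j /\ all (leq^~ (threshold v)) r.
  rewrite mem_words => /andP[/eqP -> ra]; split=> //.
  by apply: sub_all ra => x /andP[_ xa]; apply: leq_trans xa (geq_minl _ _).
rewrite /avoid_below_count (sum_words_split _ _ (geq_minr (threshold v) k)) -/a.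
congr (_ + _).
  rewrite avoid_count_words; apply: eq_big_seq => w /small[_ wv].
  by rewrite occurs_below_small.
apply: eq_bigr => j _; apply: eq_big_seq => c; rewrite mem_iota => cak.
have vc : threshold v < c by move: cak; rewrite /a; lia.
rewrite avoid_count_words big_distrl; apply: eq_big_seq => r /small[sr rv] /=.
rewrite big_distrr; apply: eq_bigr => u _ /=.
by rewrite occurs_below_cat // sr negb_or mulnb.
Qed.

End Threshold.

Lemma wilf_equiv_avoid_count (p q : vincular) :
  wilf_equiv p q -> forall n k, avoid_count p n k = avoid_count q n k.
Proof.
move=> pq [|n] [|k]; try exact: pq; rewrite !avoid_count_words ?big_nil //.
by have := pq 0 1 isT; rewrite !avoid_count_words.
Qed.

Lemma wilf_equiv_dashl (tau rho sigma : seq nat) :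
  0 < size tau -> 0 < size rho -> 0 < size sigma ->
  allrel ltn tau sigma -> allrel ltn rho sigma ->
  wilf_equiv (subword tau) (subword rho) ->
  wilf_equiv (dash tau sigma) (dash rho sigma).
Proof.
move=> tau0 rho0 sigma0 ts rs /wilf_equiv_avoid_count tr n k _.
rewrite !avoid_count_dash //; move: [::].
elim/ltn_ind: n => n IHn v; rewrite !avoid_below_count_recr //= tr.
congr (_ + _); apply: eq_bigr => j _; apply: eq_bigr => c _.
by rewrite tr IHn //; have := ltn_ord j; lia.
Qed.

Lemma allrel_ltn_revcomp (l : nat) (u v : seq nat) :
  all (leq^~ l) v -> allrel ltn u v -> allrel ltn (revcomp l v) (revcomp l u).
Proof.
move=> /allP vl /allrelP uv; apply/allrelP=> a b.
rewrite !mem_rev => /mapP[y yv ->] /mapP[x xu ->] /=.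
by have /= := uv x y xu yv; have /= := vl y yv; lia.
Qed.

Lemma wilf_equiv_dashr (tau rho sigma : seq nat) :
  0 < size tau -> 0 < size rho -> 0 < size sigma ->
  allrel ltn sigma tau -> allrel ltn sigma rho ->
  wilf_equiv (subword tau) (subword rho) ->
  wilf_equiv (dash sigma tau) (dash sigma rho).
Proof.
move=> tau0 rho0 sigma0 st sr tr n k k1.
pose l := \max_(x <- sigma ++ tau ++ rho) x.
have : all (leq^~ l) (sigma ++ tau ++ rho).
  by apply/allP=> x xl; apply: (leq_bigmax_seq x).
rewrite !all_cat => /and3P[sl tl rl].
rewrite -(@avoid_count_dash_revcomp l sigma tau) //.
rewrite -(@avoid_count_dash_revcomp l sigma rho) //.
apply: wilf_equiv_dashl; rewrite ?size_rev ?size_map ?allrel_ltn_revcomp //.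
by move=> m j j1; rewrite !avoid_count_subword_revcomp // tr.
Qed.

Lemma largest_letter_size_gt0 (u : seq nat) (s : nat) :
  largest_letter u s -> 0 < size u.
Proof. by case/andP; case: u. Qed.

Lemma allrel_ltn_shift (u v : seq nat) (s : nat) :
  largest_letter u s -> is_pattern v -> allrel ltn u (shift v s).
Proof.
move=> /andP[_ /allP us] [l vl]; apply/allrelP=> x _ /us /= xs /mapP[y + ->].
by rewrite vl mem_iota; lia.
Qed.

Theorem theorem2p1 (tau rho sigma : seq nat) (s t : nat) :
  is_pattern tau -> largest_letter tau s ->
  is_pattern rho -> largest_letter rho s ->
  wilf_equiv (subword tau) (subword rho) ->
  is_pattern sigma -> largest_letter sigma t ->
  0 < size sigma -> monotonic sigma ->
  wilf_equiv (dash tau (shift sigma s)) (dash rho (shift sigma s)) /\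
  wilf_equiv (dash sigma (shift tau t)) (dash sigma (shift rho t)).
Proof.
move=> tau_pat tau_s rho_pat rho_s tau_rho sigma_pat sigma_t sigma0 _.
have tau0 := largest_letter_size_gt0 tau_s.
have rho0 := largest_letter_size_gt0 rho_s.
split.
  by apply: wilf_equiv_dashl; rewrite ?size_map ?allrel_ltn_shift.
apply: wilf_equiv_dashr; rewrite ?size_map ?allrel_ltn_shift //.
by move=> n k k1; rewrite !avoid_count_subword_shift tau_rho.
Qed.
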